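(* Let $\lambda$ be a $b$-partition of $n$ and let $\varphi\colon W^{|\lambda|}\times\mathrm{SYT}^\lambda_0\to\mathrm{YT}^\lambda$ be the map $\varphi(w,\tau_0)=w\cdot\tau_0$. Then $\varphi$ is injective with image equal to $\mathrm{SYT}^\lambda$, and so the $W$-action on $\mathrm{YT}^\lambda$ induces a bijection between $W^{|\lambda|}\times\mathrm{SYT}^\lambda_0$ and $\mathrm{SYT}^\lambda$. Therefore, given $\tau\in\mathrm{SYT}^\lambda$, there is a unique $w\in W^{|\lambda|}$ and a unique $\tau_0\in\mathrm{SYT}^\lambda_0$ such that $\tau=w\cdot\tau_0$.
   Context: Let $n,b$ be positive integers and $[l]=\{1,\dots,l\}$. $W$ is the group of permutation matrices in $\mathrm{GL}_n(\mathbb C)$, identified with the symmetric group on $[n]$ via $wv_i=v_{w(i)}$ on the standard basis $v_1,\dots,v_n$. A $b$-partition of $n$ is a $b$-tuple $\lambda=(\lambda^1,\dots,\lambda^b)$ of (possibly empty) partitions with $|\lambda^1|+\dots+|\lambda^b|=n$; put $|\lambda|=(|\lambda^1|,\dots,|\lambda^b|)$. A Young $b$-tableau $\tau=(\tau^1,\dots,\tau^b)$ of shape $\lambda$ is a bijective filling of the boxes of the Young diagrams of $\lambda^1,\dots,\lambda^b$ (taken together) by $1,\dots,n$; it is standard if the entries in each row and column of each $\tau^j$ are increasing. $\mathrm{YT}^\lambda$ is the set of Young $b$-tableaux of shape $\lambda$ and $\mathrm{SYT}^\lambda$ the subset of standard ones. For $\tau\in\mathrm{YT}^\lambda$ and $i\in[n]$,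 $\tau_i=j$ means that $i$ appears in $\tau^j$. $\mathrm{SYT}^\lambda_0=\{\tau\in\mathrm{SYT}^\lambda\mid\tau_1\le\dots\le\tau_n\}$. $W$ acts on $\mathrm{YT}^\lambda$: $w\cdot\tau$ is obtained by applying the permutation $w$ to the entries of $\tau$. For a $b$-tuple $\alpha=(m_1,\dots,m_b)$ of non-negative integers with sum $n$, put $\bar m_0=0$, $\bar m_j=m_1+\dots+m_j$, $M_j=[\bar m_j]\setminus[\bar m_{j-1}]$ for $j\in[b]$, and $W_\alpha=\{w\in W\mid w(M_j)=M_j\ \forall j\in[b]\}$. $W^\alpha$ is the set of minimal length left coset representatives of $W_\alpha$ in $W$ (with respect to the simple transpositions $s_i=(i\ i{+}1)$); equivalently, $W^\alpha$ is the set of $w\in W$ whose restriction to each $M_j$ is increasing. *)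

(* Defs.v *)
From HB Require Import structures.
From mathcomp Require Import all_boot all_fingroup.

Set Implicit Arguments.
Unset Strict Implicit.
Unset Printing Implicit Defensive.

(* The set [n] = {1, ..., n} is rendered as 'I_n = {0, ..., n-1}; entries,
   components, rows and columns are all numbered from 0. *)

Definition is_partition (p : seq nat) : bool := sorted geq p && (0 \notin p).

Record multipartition (b n : nat) := MultiPartition {
  parts :> b.-tuple (seq nat);
  multipartitionP :
    all is_partition parts && (\sum_(j < b) sumn (tnth parts j) == n) }.

Definition mshape b n (lam : multipartition b n) : b.-tuple nat :=
  [tuple sumn (tnth lam j) | j < b].

Section SymmetricGroup.

Variable n : nat.

Definition simple_transp : {set 'S_n} :=
  [set tperm p.1 p.2 | p : 'I_n * 'I_n & p.2 == p.1.+1 :> nat].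

Definition has_word (w : 'S_n) (k : nat) : bool :=
  [exists c : k.-tuple 'S_n,
     all [in simple_transp] c && (\prod_(s <- c) s == w)%g].

Lemma tperm_gen_simple (i j : 'I_n) :
  i < j -> tperm i j \in <<simple_transp>>%g.
Proof.
case: j => j; elim: j => [//|j IHj] ltjn /= ltij.
have ltjn' : j < n by apply: ltnW.
have sj : tperm (Ordinal ltjn') (Ordinal ltjn) \in <<simple_transp>>%g.
  apply: mem_gen; apply/imsetP.
  by exists (Ordinal ltjn', Ordinal ltjn); rewrite ?inE.
move: ltij; rewrite ltnS leq_eqVlt => /orP[/eqP eij|ltij].
  by have -> : i = Ordinal ltjn' by apply: val_inj.
have := groupJ (IHj ltjn' ltij) sj.
rewrite tpermJ tpermL tpermD //; apply/eqP => /(congr1 val) /= eji.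
  by rewrite eji ltnn in ltij.
by rewrite -eji ltnNge leqnSn in ltij.
Qed.

Lemma ex_word (w : 'S_n) : exists k, has_word w k.
Proof.
have : w \in <<simple_transp>>%g.
  have [ts -> _] := prod_tpermP w; apply: group_prod => -[i j] _ /=.
  case: (ltngtP i j) => [|ltji|/val_inj ->]; first exact: tperm_gen_simple.
    by rewrite tpermC tperm_gen_simple.
  by rewrite tperm1 group1.
case/gen_prodgP => k [c cS ->]; exists k.
apply/existsP; exists [tuple c i | i < k]; apply/andP; split.
  by apply/all_tnthP => i; rewrite tnth_mktuple; apply: cS.
by rewrite big_tuple; apply/eqP/eq_bigr => i _; rewrite tnth_mktuple.
Qed.

Definition coxeter_length (w : 'S_n) : nat := ex_minn (ex_word w).

Variables (b : nat) (alpha : b.-tuple nat).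

Definition mbar (k : nat) : nat := \sum_(l < b | l < k) tnth alpha l.

Definition Mblock (j : 'I_b) : {set 'I_n} :=
  [set i : 'I_n | mbar j <= i < mbar j.+1].

Definition young_subgroup : {set 'S_n} :=
  [set w : 'S_n | [forall j : 'I_b, w @: Mblock j == Mblock j]].

(* The product of 'S_n is (u * w) i = w (u i), that is, w o u.  Hence the left
   coset {w o u | u in W_alpha} is the right coset in the product of 'S_n. *)
Definition min_coset_reps : {set 'S_n} :=
  [set w : 'S_n |
    [forall v in (young_subgroup :* w)%g, coxeter_length w <= coxeter_length v]].

End SymmetricGroup.

Section Tableaux.

Variables (b n : nat) (lam : multipartition b n).

Definition box : finType :=
  {j : 'I_b & {r : 'I_(size (tnth lam j)) & 'I_(nth 0 (tnth lam j) r)}}.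

Definition box_comp (x : box) : 'I_b := tag x.
Definition box_row (x : box) : nat := tag (tagged x).
Definition box_col (x : box) : nat := tagged (tagged x).

Definition bij_filling (f : {ffun box -> 'I_n}) : bool :=
  injectiveb f && [forall i, i \in codom f].

Record tableau := Tableau {
  filling :> {ffun box -> 'I_n};
  fillingP : bij_filling filling }.

HB.instance Definition _ := [isSub for filling].
HB.instance Definition _ := [Finite of tableau by <:].

Lemma tableau_codom (t : tableau) (i : 'I_n) : i \in codom t.
Proof. by have /andP[_ /forallP] := fillingP t. Qed.

(* component t i is the index written tau_i for a tableau tau. *)
Definition component (t : tableau) (i : 'I_n) : 'I_b :=
  box_comp (iinv (tableau_codom t i)).

Definition standard (t : tableau) : bool :=
  [forall x : box, forall y : box, (box_comp x == box_comp y) ==>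
    ((box_row x == box_row y) && (box_col x < box_col y) ==> (t x < t y)) &&
    ((box_col x == box_col y) && (box_row x < box_row y) ==> (t x < t y))].

Definition SYT : {set tableau} := [set t | standard t].

Definition SYT0 : {set tableau} :=
  [set t in SYT | sorted leq [seq val (component t i) | i : 'I_n]].

Lemma permute_bij (t : tableau) (w : 'S_n) :
  bij_filling [ffun x => w (t x)].
Proof.
apply/andP; split.
  apply/injectiveP => x y; rewrite !ffunE => /perm_inj.
  by have /andP[/injectiveP injt _] := fillingP t; apply: injt.
apply/forallP => i; have /codomP[x ex] := tableau_codom t (w^-1%g i).
by apply/codomP; exists x; rewrite ffunE -ex permKV.
Qed.

Definition permute_entries (t : tableau) (w : 'S_n) : tableau :=
  Tableau (permute_bij t w).

Lemma permute_entries1 : permute_entries^~ 1%g =1 id.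
Proof. by move=> t; apply/val_inj/ffunP => x; rewrite ffunE perm1. Qed.

Lemma permute_entriesM t : act_morph permute_entries t.
Proof. by move=> v w; apply/val_inj/ffunP => x; rewrite !ffunE permM. Qed.

(* Left actions for composition are right actions for the product of 'S_n;
   tableau_action t w is w . t. *)
Definition tableau_action : {action 'S_n &-> tableau} :=
  TotalAction permute_entries1 permute_entriesM.

End Tableaux.

(* Main.v *)
Require Import Defs.
From mathcomp Require Import all_boot all_fingroup.

Set Implicit Arguments.
Unset Strict Implicit.
Unset Printing Implicit Defensive.

(** The component function of a tableau [t] is constant along the action:
    [w i] lies in the same component of [w . t] as [i] does in [t].  If [t0]
    is in SYT_0, its component function is weakly increasing and takes the
    value [j] exactly |lambda^j| times, so the entries of component [j] are
    precisely those of the interval M_j ([Mblock_component]).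

    Now let [w . t0 = t], and order the entries of [t] lexicographically: first
    by component, then by size.  The value [entry_key t i] encodes this total
    order.  That [t0] is in SYT_0 and [w] is increasing on each M_j says
    exactly that [t0] is standard and that [w] lists the entries of [t] in this
    order.  A finite totally ordered set has exactly one increasing listing
    ([increasing_listing_exists], [increasing_listing_unique]), so [t]
    determines [w], and hence [t0].  Standardness passes between [t] and [t0]
    because it only compares entries of one component, and [w] is increasing
    on those.

    It remains to identify the minimal length representatives of the cosets of
    W_alpha with the permutations that are increasing on each M_j
    ([min_coset_repsP]).  The length of a permutation is its number of
    inversions ([coxeter_length_inversions]).  A descent of [w] inside a block
    can be removed by a simple transposition in W_alpha, which shortens [w];
    conversely, if [w] is increasing on blocks, its inversions occur between
    different blocks, and moving them by an element of W_alpha embeds them in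
    the inversions of any other element of the coset. *)

(** * Increasing functions and permutations of ordinals *)

Lemma increasing_on_interval n (f : 'I_n -> nat) lo hi :
  (forall i i' : 'I_n, lo <= i -> i' < hi -> i' = i.+1 :> nat -> f i < f i') ->
  forall i i' : 'I_n, lo <= i -> i < i' -> i' < hi -> f i < f i'.
Proof.
move=> asc i [i' lti'n]; elim: i' lti'n => [|k IHk] ltkn //= loi ltik ltkhi.
pose k' := Ordinal (ltnW ltkn).
have lok : lo <= k' by rewrite (leq_trans loi).
have step : f k' < f (Ordinal ltkn) by apply: asc.
move: ltik; rewrite ltnS leq_eqVlt => /orP[/eqP eik|ltik].
  by have -> : i = k' by apply: val_inj.
exact: ltn_trans (IHk _ loi ltik (ltnW ltkhi)) step.
Qed.

(** An increasing map satisfies [i <= u i]; the inverse of [u] is increasing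
    too, which gives the opposite inequality. *)
Lemma increasing_perm1 n (u : 'S_n) :
  (forall i i' : 'I_n, i < i' -> u i < u i') -> u = 1%g.
Proof.
have geid (v : 'S_n) :
    (forall i i' : 'I_n, i < i' -> v i < v i') -> forall i : 'I_n, i <= v i.
  move=> incv [i ltin]; elim: i ltin => [//|k IHk] ltkn.
  apply: leq_ltn_trans (IHk (ltnW ltkn)) _.
  by apply: incv => /=.
move=> incu.
have incV (i i' : 'I_n) : i < i' -> u^-1%g i < u^-1%g i'.
  move=> ltii'; case: ltngtP => // [/incu|/val_inj/perm_inj eii'].
    by rewrite !permKV ltnNge (ltnW ltii').
  by rewrite eii' ltnn in ltii'.
apply/permP => i; rewrite perm1; apply/val_inj/anti_leq.
by rewrite geid // andbT -{2}[i](permK u) geid.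
Qed.

Lemma increasing_listing_unique n (key : 'I_n -> nat) (w w' : 'S_n) :
    (forall i i' : 'I_n, i < i' -> key (w i) < key (w i')) ->
    (forall i i' : 'I_n, i < i' -> key (w' i) < key (w' i')) ->
  w = w'.
Proof.
move=> incw incw'; apply/eqP; rewrite eq_mulgV1; apply/eqP.
apply: increasing_perm1 => i i' ltii'; rewrite !permM ltnNge leq_eqVlt.
apply/negP => /orP[/eqP/val_inj/perm_inj/perm_inj eii'|/incw'].
  by rewrite eii' ltnn in ltii'.
by rewrite !permKV ltnNge ltnW // incw.
Qed.

(** The inverse of the listing sends each element to its rank, the number of
    elements with a smaller key. *)
Lemma increasing_listing_exists n (key : 'I_n -> nat) :
  injective key ->
  exists w : 'S_n, forall i i' : 'I_n, i < i' -> key (w i) < key (w i').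
Proof.
move=> key_inj; pose below i := [set i' | key i' < key i].
have rank_lt i : #|below i| < n.
  rewrite -[ltnRHS]card_ord -cardsT proper_card // properT.
  by apply/eqP/setP => /(_ i); rewrite !inE ltnn.
pose rank i := Ordinal (rank_lt i).
have rank_mono i i' : key i < key i' -> rank i < rank i'.
  move=> ltii'; rewrite proper_card //; apply/properP; split.
    by apply/subsetP => x; rewrite !inE => /ltn_trans; apply.
  by exists i; rewrite !inE ?ltnn.
have rank_inj : injective rank.
  move=> i i' eii'.
  case: (ltngtP (key i) (key i')) => [||/key_inj//] /rank_mono;
    by rewrite eii' ltnn.
exists (perm rank_inj)^-1%g => i i' ltii'.
set a := _ i; set a' := _ i'.
have ra : rank a = i by rewrite -(permE rank_inj) permKV.
have ra' : rank a' = i' by rewrite -(permE rank_inj) permKV.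
case: ltngtP => // [/rank_mono|/key_inj eaa'].
  by rewrite ra ra' ltnNge (ltnW ltii').
by rewrite -ra -ra' eaa' ltnn in ltii'.
Qed.

Lemma mem_down_closed n (D : {set 'I_n}) :
    (forall i i' : 'I_n, i <= i' -> i' \in D -> i \in D) ->
  forall i : 'I_n, (i \in D) = (i < #|D|).
Proof.
move=> downD i.
have cardI m : m <= n -> #|[set x : 'I_n | x < m]| = m.
  move=> lemn; rewrite -sum1dep_card -(big_ord_widen n (fun _ => 1) lemn).
  by rewrite sum1_card card_ord.
apply/idP/idP => [Di|].
  have := cardI i.+1 (ltn_ord i) => <-; apply/subset_leq_card/subsetP => x.
  by rewrite inE ltnS => lexi; apply: downD Di.
apply: contraLR => nDi; rewrite -leqNgt -[leqRHS](cardI i (ltnW (ltn_ord i))).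
apply/subset_leq_card/subsetP => x Dx; rewrite inE ltnNge.
by apply: contra nDi => leix; apply: downD Dx.
Qed.

(** * Length and inversions *)

Definition inversions n (w : 'S_n) : {set 'I_n * 'I_n} :=
  [set p : 'I_n * 'I_n | p.1 < p.2 & w p.2 < w p.1].

(** The transposition [(i i')] of adjacent elements reverses the order of no
    pair other than [(i, i')] itself. *)
Lemma inversions_simple_transp n (w : 'S_n) (i i' : 'I_n) :
    i' = i.+1 :> nat ->
  #|inversions (tperm i i' * w)%g :\ (i, i')| <= #|inversions w :\ (i, i')|.
Proof.
move=> ei'; set s := tperm i i'.
pose f (p : 'I_n * 'I_n) := (s p.1, s p.2).
have f_inj : injective f by move=> [a b] [c d] [/perm_inj-> /perm_inj->].
rewrite -(card_imset _ f_inj); apply/subset_leq_card/subsetP => _ /imsetP[[x y] + ->].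
rewrite !inE /= !permM xpair_eqE => /and3P[nxy ltxy ltw].
rewrite ltw andbT /f /= xpair_eqE.
have snE (z : 'I_n) : s z = (if z == i then i' else if z == i' then i else z) :> nat.
  by rewrite permE /=; case: ifP => // _; case: ifP.
have sii' : (s x == i) && (s y == i') = (x == i') && (y == i).
  by rewrite -(inj_eq (@perm_inj _ s) x) -(inj_eq (@perm_inj _ s) y) tpermR tpermL.
rewrite sii' !snE.
move: nxy ltxy; rewrite -!(inj_eq val_inj) /= ei'.
case: (eqVneq (x : nat) i) => [ex|nx]; case: (eqVneq (y : nat) i) => [ey|ny];
  rewrite ?ex ?ey ?eqxx ?ltnn //=.
- rewrite andbF ei' => /negPf ny' ltiy.
  by rewrite ny' /= ltn_neqAle eq_sym ny' ltiy.
- move=> _ ltxi; have ltxi' := ltn_trans ltxi (leqnn _).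
  by rewrite (ltn_eqF ltxi') ei' ltxi'.
rewrite andbF; case: (eqVneq (x : nat) i.+1) => [ex'|nx'];
  case: (eqVneq (y : nat) i.+1) => [ey'|ny'] //=.
- by rewrite ex' ey' ltnn.
- by rewrite ex' => _; apply: ltn_trans.
- by rewrite ey' ltnS leq_eqVlt (negPf nx).
Qed.

Lemma leq_inversions_simple_transp n (w : 'S_n) (i i' : 'I_n) :
    i' = i.+1 :> nat ->
  #|inversions (tperm i i' * w)%g| <= #|inversions w|.+1.
Proof.
move=> ei'; rewrite (cardsD1 (i, i')) -add1n leq_add ?leq_b1 //.
apply: leq_trans (inversions_simple_transp w ei') _.
exact/subset_leq_card/subD1set.
Qed.

Lemma inversions_descent n (w : 'S_n) (i i' : 'I_n) :
    i' = i.+1 :> nat -> w i' < w i ->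
  #|inversions (tperm i i' * w)%g| < #|inversions w|.
Proof.
move=> ei' desc; rewrite [ltnRHS](cardsD1 (i, i')) inE /= ei' leqnn desc ltnS.
apply: leq_trans (inversions_simple_transp w ei').
rewrite [leqLHS](cardsD1 (i, i')) inE /= !permM tpermL tpermR.
by rewrite [w i < _]ltnNge (ltnW desc) andbF.
Qed.

Lemma inversions1 n : inversions (1 : 'S_n)%g = set0.
Proof.
apply/setP => -[x y]; rewrite !inE !perm1 /=.
by case: ltngtP.
Qed.

Lemma has_word_inversions n (w : 'S_n) k : has_word w k -> #|inversions w| <= k.
Proof.
case/existsP => -[c /= /eqP <-] /andP[/= simple_c /eqP <-] {w k}.
elim: c simple_c => [_|s c IHc /= /andP[/imsetP[[i i'] /[!inE] /= /eqP ei' ->]]].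
  by rewrite big_nil inversions1 cards0.
rewrite big_cons => /IHc; rewrite -ltnS; apply: leq_trans.
exact: leq_inversions_simple_transp.
Qed.

Lemma has_word1 n : has_word (1 : 'S_n)%g 0.
Proof. by apply/existsP; exists [tuple]; rewrite /= big_nil eqxx. Qed.

Lemma has_wordM n (w : 'S_n) (i i' : 'I_n) k :
  i' = i.+1 :> nat -> has_word w k -> has_word (tperm i i' * w)%g k.+1.
Proof.
move=> ei' /existsP[c /andP[simple_c /eqP <-]]; apply/existsP.
exists [tuple of tperm i i' :: c]; rewrite /= simple_c andbT big_cons eqxx andbT.
by apply/imsetP; exists (i, i'); rewrite // inE /= ei'.
Qed.

(** Sorting: removing descents one at a time reaches the identity. *)
Lemma short_word n (w : 'S_n) : exists2 k, k <= #|inversions w| & has_word w k.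
Proof.
have [m] := ubnP #|inversions w|; elim: m w => // m IHm w; rewrite ltnS => lem.
case: (boolP [exists p : 'I_n * 'I_n, (p.2 == p.1.+1 :> nat) && (w p.2 < w p.1)]).
  case/existsP => -[i i'] /= /andP[/eqP ei' desc].
  have lt := inversions_descent ei' desc.
  have [k lek wordk] := IHm _ (leq_trans lt lem).
  exists k.+1; first exact: leq_ltn_trans lek lt.
  by rewrite -[w](mulKg (tperm i i')) tpermV has_wordM.
move=> /existsPn nodesc; exists 0 => //.
rewrite (@increasing_perm1 _ w) ?has_word1 // => i i' ltii'.
apply: (@increasing_on_interval _ (fun x => w x) 0 n) => // {ltii'}i {}i' _ _ ei'.
have := nodesc (i, i'); rewrite /= ei' eqxx /= -leqNgt leq_eqVlt.
case/orP => // /eqP/val_inj/perm_inj eii'.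
by move: ei'; rewrite eii' => /n_Sn.
Qed.

Lemma coxeter_length_inversions n (w : 'S_n) :
  coxeter_length w = #|inversions w|.
Proof.
rewrite /coxeter_length; case: ex_minnP => k wordk mink; apply/anti_leq.
rewrite (has_word_inversions wordk) andbT.
by have [k' lek' /mink lekk'] := short_word w; apply: leq_trans lek'.
Qed.

(** * Minimal coset representatives *)

Section Blocks.

Variables (n b : nat) (alpha : b.-tuple nat).
Implicit Types (i : 'I_n) (j : 'I_b).

Local Notation M := (Mblock n alpha).

Lemma mbar_mono k k' : k <= k' -> mbar alpha k <= mbar alpha k'.
Proof.
move=> lekk'; rewrite /mbar [leqRHS]big_mkcond [leqLHS]big_mkcond leq_sum // => j _.
by case: ifP => // /leq_trans -> .
Qed.

Lemma Mblock_lt i i' j j' : i \in M j -> i' \in M j' -> j < j' -> i < i'.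
Proof.
rewrite !inE => /andP[_ lti] /andP[lei' _] /mbar_mono lejj'.
exact: leq_trans lti (leq_trans lejj' lei').
Qed.

Lemma Mblock_inj i j j' : i \in M j -> i \in M j' -> j = j'.
Proof.
move=> Mj Mj'; case: (ltngtP j j') => [lt|lt|/val_inj//].
  by have := Mblock_lt Mj Mj' lt; rewrite ltnn.
by have := Mblock_lt Mj' Mj lt; rewrite ltnn.
Qed.

Lemma Mblock_cover i : mbar alpha b = n -> exists j, i \in M j.
Proof.
move=> sum_n; have ex : exists k, i < mbar alpha k by exists b; rewrite sum_n.
case: (ex_minnP ex) => -[|k]; first by rewrite /mbar big_pred0.
move=> ltik mink; have ltkb : k < b by apply: mink; rewrite sum_n.
exists (Ordinal ltkb); rewrite inE /= ltik andbT leqNgt.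
by apply/negP => /mink; rewrite ltnn.
Qed.

Lemma young_subgroup_Mblock u i j :
  u \in young_subgroup n alpha -> (u i \in M j) = (i \in M j).
Proof.
rewrite inE => /forallP/(_ j)/eqP uM.
by rewrite -{1}uM mem_imset //; apply: perm_inj.
Qed.

Lemma tperm_young_subgroup i i' j :
  i \in M j -> i' \in M j -> tperm i i' \in young_subgroup n alpha.
Proof.
move=> Mi Mi'; rewrite inE; apply/forallP => j'.
rewrite eqEcard card_imset ?leqnn ?andbT; last exact: perm_inj.
apply/subsetP => _ /imsetP[x Mx ->]; case: tpermP Mx => [-> | -> | //] Mx.
  by rewrite (Mblock_inj Mx Mi).
by rewrite (Mblock_inj Mx Mi').
Qed.

Definition increasing_on_blocks (w : 'S_n) : Prop :=
  forall j i i', i \in M j -> i' \in M j -> i < i' -> w i < w i'.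

(** The hypothesis says that the blocks cover [n]: elements outside of them could
    be permuted freely by W_alpha, and being increasing on blocks would not
    control their inversions. *)
Lemma min_coset_repsP w : mbar alpha b = n ->
  w \in min_coset_reps n alpha <-> increasing_on_blocks w.
Proof.
move=> sum_n; rewrite inE; split => [/forallP minw j i i'|incw].
  rewrite !inE => /andP[loi _] /andP[_ i'hi] ltii'.
  apply: (increasing_on_interval (f := fun x => w x)) loi ltii' i'hi => {}i {}i' loi i'hi ei'.
  have Mi : i \in M j by rewrite inE loi -ltnS -ei' ltnW.
  have Mi' : i' \in M j by rewrite inE i'hi ei' andbT leqW.
  rewrite ltnNge leq_eqVlt; apply/negP => /orP[/eqP/val_inj/perm_inj eii'|desc].
    by move: ei'; rewrite eii' => /n_Sn.
  have := minw (tperm i i' * w)%g.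
  rewrite mem_rcoset mulgK (tperm_young_subgroup Mi Mi') /=.
  by rewrite !coxeter_length_inversions leqNgt inversions_descent.
apply/forallP => v; apply/implyP => /rcosetP[u Wu ->].
rewrite !coxeter_length_inversions.
(* An element of W_alpha preserves blocks, hence the order of two entries in
   different blocks, and every inversion of w is such a pair. *)
pose f (p : 'I_n * 'I_n) := (u^-1 p.1, u^-1 p.2)%g.
have f_inj : injective f by move=> [a c] [a' c'] [/perm_inj-> /perm_inj->].
rewrite -(card_imset _ f_inj); apply/subset_leq_card/subsetP => _ /imsetP[[x y] + ->].
rewrite !inE /= => /andP[ltxy ltw]; rewrite !permM !permKV ltw andbT.
have [[j Mx] [j' My]] := (Mblock_cover x sum_n, Mblock_cover y sum_n).
have Mux : u^-1%g x \in M j by rewrite -(young_subgroup_Mblock _ _ Wu) permKV.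
have Muy : u^-1%g y \in M j' by rewrite -(young_subgroup_Mblock _ _ Wu) permKV.
apply: (Mblock_lt Mux Muy); rewrite ltnNge leq_eqVlt.
apply/negP => /orP[/eqP/val_inj ejj'|ltj'j].
  by rewrite ejj' in My; have := incw _ _ _ Mx My ltxy; rewrite ltnNge (ltnW ltw).
by have := Mblock_lt My Mx ltj'j; rewrite ltnNge (ltnW ltxy).
Qed.

End Blocks.

(** * Components of tableaux *)

Section Components.

Variables (b n : nat) (lam : multipartition b n).
Implicit Types (t : tableau lam) (w : 'S_n) (i : 'I_n).

Lemma mbar_mshape : mbar (mshape lam) b = n.
Proof.
have /andP[_ /eqP sum_n] := multipartitionP lam; rewrite -[RHS]sum_n.
by apply: eq_big => [j|j _]; rewrite ?ltn_ord // tnth_mktuple.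
Qed.

Lemma filling_inj t : injective t.
Proof. by have /andP[/injectiveP] := fillingP t. Qed.

Lemma component_filling t (x : box lam) : component t (t x) = box_comp x.
Proof. by rewrite /component; congr box_comp; apply: (@filling_inj t); rewrite f_iinv. Qed.

Lemma tableau_actionE t w (x : box lam) : tableau_action lam t w x = w (t x).
Proof. by rewrite /= ffunE. Qed.

Lemma component_action t w i :
  component (tableau_action lam t w) (w i) = component t i.
Proof.
have /codomP[x ->] := tableau_codom t i.
by rewrite component_filling -tableau_actionE component_filling.
Qed.

Lemma card_box_comp_lt k :
  #|[set x : box lam | box_comp x < k]| = mbar (mshape lam) k.
Proof.
rewrite -sum1dep_card /mbar /box.
transitivity (\sum_(j < b | j < k)
   \sum_(y : {r : 'I_(size (tnth lam j)) & 'I_(nth 0 (tnth lam j) r)}) 1).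
  rewrite (sig_big_dep (fun j : 'I_b => j < k) (fun _ => predT) (fun _ _ => 1)).
  by apply: eq_bigl => x; rewrite andbT.
apply: eq_bigr => j _; rewrite tnth_mktuple sum1_card card_tagged.
rewrite sumnE big_map big_enum /= sumnE (big_nth 0) big_mkord.
by apply: eq_bigr => r _; rewrite card_ord.
Qed.

Lemma card_component_lt t k :
  #|[set i | component t i < k]| = mbar (mshape lam) k.
Proof.
rewrite -card_box_comp_lt -(card_imset _ (@filling_inj t)); apply: eq_card => i.
apply/idP/imsetP => [|[x + ->]]; last by rewrite !inE component_filling.
have /codomP[x ->] := tableau_codom t i.
by rewrite inE component_filling => lt; exists x; rewrite // inE.
Qed.

Lemma sorted_component t :
  sorted leq [seq val (component t i) | i : 'I_n] <->
  (forall i i', i <= i' -> component t i <= component t i').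
Proof.
have size_comp : size [seq val (component t i) | i : 'I_n] = n.
  by rewrite size_image card_ord.
have nth_comp i : nth 0 [seq val (component t i) | i : 'I_n] i = component t i.
  by rewrite (nth_map i) ?size_enum_ord // nth_ord_enum.
split => [sorted_t i i' leii'|mono_t].
  by rewrite -!nth_comp (sorted_leq_nth leq_trans leqnn) // inE size_comp ltn_ord.
apply/(sortedP 0) => k; rewrite size_comp => ltkn.
by rewrite (nth_comp (Ordinal (ltnW ltkn))) (nth_comp (Ordinal ltkn)) mono_t /=.
Qed.

(** The entries in components before the [k]th form an initial segment, of
    size [mbar k]. *)
Lemma Mblock_component t i j :
    (forall i i', i <= i' -> component t i <= component t i') ->
  (i \in Mblock n (mshape lam) j) = (component t i == j).
Proof.
move=> mono_t.
have ltE k : (i < mbar (mshape lam) k) = (component t i < k).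
  rewrite -(card_component_lt t) -mem_down_closed ?inE // => x y lexy.
  by rewrite !inE; apply: leq_ltn_trans; apply: mono_t.
by rewrite inE leqNgt !ltE -leqNgt ltnS -eqn_leq eq_sym.
Qed.

Lemma standard_transfer t t' :
    (forall x y, box_comp x = box_comp y -> t x < t y -> t' x < t' y) ->
  standard t -> standard t'.
Proof.
move=> tt' /forallP st; apply/forallP => x; apply/forallP => y.
apply/implyP => cxy; have /andP[/implyP row /implyP col] := implyP (forallP (st x) y) cxy.
by apply/andP; split; apply/implyP; [move/row | move/col]; apply: tt'; apply/eqP.
Qed.

(** Encodes the lexicographic order on pairs (component, entry); the base [n]
    exceeds every entry. *)
Definition entry_key t i : nat := component t i * n + i.

Lemma entry_key_lt_component t i i' :
  component t i < component t i' -> entry_key t i < entry_key t i'.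
Proof.
move=> lt; rewrite /entry_key; apply: leq_trans (leq_addr _ _).
by apply: leq_trans (leq_mul lt (leqnn n)); rewrite mulSn addnC ltn_add2r.
Qed.

Lemma entry_key_same_component t i i' : component t i = component t i' ->
  (entry_key t i < entry_key t i') = (i < i').
Proof. by rewrite /entry_key => ->; rewrite ltn_add2l. Qed.

Lemma entry_key_inj t : injective (entry_key t).
Proof.
move=> i i' ekey; case: (ltngtP (component t i) (component t i')).
- by move/entry_key_lt_component; rewrite ekey ltnn.
- by move/entry_key_lt_component; rewrite ekey ltnn.
by move/val_inj => ecomp; apply/val_inj; move: ekey; rewrite /entry_key ecomp => /addnI.
Qed.

Lemma SYT0P t : reflect
  (standard t /\ forall i i', i <= i' -> component t i <= component t i')
  (t \in SYT0 lam).
Proof.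
by rewrite !inE; apply: (iffP andP) => -[st /sorted_component].
Qed.

Lemma standard_action t w :
  w \in min_coset_reps n (mshape lam) -> t \in SYT0 lam ->
  standard (tableau_action lam t w).
Proof.
move=> /(min_coset_repsP _ mbar_mshape) incw /SYT0P[st mono_t].
apply: standard_transfer st => x y cxy; rewrite !tableau_actionE.
by apply: (incw (box_comp x)); rewrite (Mblock_component _ _ mono_t) component_filling ?cxy.
Qed.

Lemma entry_key_action t w :
  w \in min_coset_reps n (mshape lam) -> t \in SYT0 lam ->
  forall i i' : 'I_n, i < i' ->
  entry_key (tableau_action lam t w) (w i) < entry_key (tableau_action lam t w) (w i').
Proof.
move=> /(min_coset_repsP _ mbar_mshape) incw /SYT0P[_ mono_t] i i' ltii'.
have := mono_t _ _ (ltnW ltii'); rewrite leq_eqVlt => /orP[/eqP/val_inj ecomp|lt].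
  rewrite entry_key_same_component ?component_action //.
  by apply: incw ltii'; rewrite (Mblock_component _ _ mono_t) ?ecomp.
by apply: entry_key_lt_component; rewrite !component_action.
Qed.

Lemma action_inj t t' w w' :
    w \in min_coset_reps n (mshape lam) -> t \in SYT0 lam ->
    w' \in min_coset_reps n (mshape lam) -> t' \in SYT0 lam ->
  tableau_action lam t w = tableau_action lam t' w' -> w = w' /\ t = t'.
Proof.
move=> minw t0 minw' t'0 eq_act.
have eww' : w = w'.
  apply: (@increasing_listing_unique _ (entry_key (tableau_action lam t w))).
    exact: entry_key_action.
  by rewrite eq_act; apply: entry_key_action.
by split=> //; move: eq_act; rewrite eww'; apply: act_inj.
Qed.

Lemma action_surj t : standard t ->
  exists w t0, [/\ w \in min_coset_reps n (mshape lam), t0 \in SYT0 lam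
    & t = tableau_action lam t0 w].
Proof.
move=> st; have [w incw] := increasing_listing_exists (@entry_key_inj t).
have [t0 et] : exists t0, t = tableau_action lam t0 w.
  by exists (tableau_action lam t w^-1%g); rewrite actKV.
have comp_t0 i : component t0 i = component t (w i).
  by rewrite et component_action.
have mono_t0 i i' : i <= i' -> component t0 i <= component t0 i'.
  rewrite leq_eqVlt => /orP[/eqP/val_inj->//|/incw ltkey]; rewrite !comp_t0 leqNgt.
  by apply/negP => /entry_key_lt_component; rewrite ltnNge (ltnW ltkey).
have st0 : standard t0.
  apply: standard_transfer st => x y cxy; rewrite et !tableau_actionE => ltxy.
  rewrite ltnNge leq_eqVlt; apply/negP => /orP[/eqP/val_inj eyx|/incw].
    by rewrite eyx ltnn in ltxy.
  rewrite entry_key_same_component ?[_ < _]ltnNge ?(ltnW ltxy) //.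
  by rewrite -!comp_t0 !component_filling.
exists w, t0; split=> //; last exact/SYT0P.
apply/(min_coset_repsP _ mbar_mshape) => j i i'.
rewrite !(Mblock_component _ _ mono_t0) !comp_t0 => /eqP ci /eqP ci' /incw.
by rewrite entry_key_same_component // ci ci'.
Qed.

End Components.

Theorem proposition3p9 (n b : nat) (n_gt0 : 0 < n) (b_gt0 : 0 < b)
    (lam : multipartition b n) :
  let phi (x : {w : 'S_n | w \in min_coset_reps n (mshape lam)} *
               {t : tableau lam | t \in SYT0 lam}) : tableau lam :=
    tableau_action lam (val x.2) (val x.1) in
  [/\ injective phi,
      [set phi x | x in predT] = SYT lam,
      exists psi : {w : 'S_n | w \in min_coset_reps n (mshape lam)} *
                   {t : tableau lam | t \in SYT0 lam} ->
                   {t : tableau lam | t \in SYT lam},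
        bijective psi /\ (forall x, val (psi x) = phi x)
    & forall tau : tableau lam, tau \in SYT lam ->
        exists! x : 'S_n * tableau lam,
          [/\ x.1 \in min_coset_reps n (mshape lam), x.2 \in SYT0 lam
            & tau = tableau_action lam x.2 x.1]].
Proof.
move=> phi.
have phi_inj : injective phi.
  move=> [[w Pw] [t Pt]] [[w' Pw'] [t' Pt']] /= /(action_inj Pw Pt Pw' Pt')[ew et].
  by congr pair; apply: val_inj.
have phiS x : phi x \in SYT lam.
  by rewrite inE; apply: standard_action; apply: valP.
have surj t : t \in SYT lam -> exists x, t = phi x.
  rewrite inE => /action_surj[w [t0 [Pw Pt0 ->]]].
  by exists (Sub w Pw, Sub t0 Pt0).
split=> //.
- apply/setP => t; apply/imsetP/idP => [[x _ ->] //|/surj[x ->]].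
  by exists x.
- exists (fun x => Sub (phi x) (phiS x)); split=> //.
  have psi_inj : injective (fun x => Sub (phi x) (phiS x) : {t | t \in SYT lam}).
    by move=> x y /(congr1 val)/phi_inj.
  (* Surjectivity of psi follows by counting: SYT is covered by the image of phi. *)
  apply: (inj_card_bij psi_inj).
  rewrite -(card_imset predT phi_inj) card_sub; apply/subset_leq_card/subsetP => t.
  by move=> /surj[x ->]; apply: imset_f.
move=> t; rewrite inE => /action_surj[w [t0 [Pw Pt0 et]]].
exists (w, t0); split=> // -[w' t0'] [/= Pw' Pt0' et'].
by have [|-> ->] := action_inj Pw Pt0 Pw' Pt0'; rewrite -?et.
Qed.
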